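(* Let $K$ be an interface element, let $\widehat A_1,\dots,\widehat A_{2^N}$ be the vertices of $\widehat K$, and let the flux-enforcement point $\widehat M_K$ be selected as described in the context. For any prescribed nodal values $\{c_i\}_{i=1}^{2^N}\subset\mathbb R$, there exists a unique $\widehat\phi\in\widehat V_K^{\rm IFE}(\widehat K)$ such that $\widehat\phi(\widehat A_i)=c_i$, $i=1,\dots,2^N$.
   Context: Let $N\in\{2,3\}$, let $\Omega\subset\mathbb R^N$ be a bounded convex polygonal/polyhedral domain and $\Gamma\subset\Omega$ a closed $C^2$ hypersurface separating $\Omega$ into two subdomains; $\Omega^-$ is one of them and $\Omega^+$ is the other one together with $\Gamma$. $n$ is the unit normal to $\Gamma$ pointing toward $\Omega^+$. For a region $T$, $T^\pm=T\cap\Omega^\pm$. $\{\mathcal K_h\}_{h>0}$ is a family of conforming quadrilateral ($N=2$) / hexahedral ($N=3$) meshes of $\Omega$ generated independently of $\Gamma$; $h_K=\operatorname{diam}K$. The reference element is $\widehat K=[-1,1]^N$ with vertex set $\widehat{\mathcal N}$; $Q_1(\widehat K)=\operatorname{span}\{\widehat x_1^{\alpha_1}\cdots\widehat x_N^{\alpha_N}:\alpha_i\in\{0,1\}\}$. Each $K\in\mathcal K_h$ is $F_K(\widehat K)$ with $F_K\in Q_1(\widehat K)^N$ bijective onto $K$, $J_K=DF_K$, $\det J_K>0$ on $\widehat K$. $K$ is an interface element if $\Gamma\cap\operatorname{int}(K)\ne\emptyset$; then $\Gamma_K=\Gamma\cap K$, $\widehat\Gamma_K=F_K^{-1}(\Gamma_K)$,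 $\widehat K^\pm=F_K^{-1}(K^\pm)$. On an interface element $K$ one selects a point $x_K\in K$ and a constant unit vector $n_h$ and sets $\widehat x_K=F_K^{-1}(x_K)$, $\widehat n_h=J_K(\widehat x_K)^\top n_h/|J_K(\widehat x_K)^\top n_h|$, $\widehat\ell_K(\widehat x)=(\widehat x-\widehat x_K)\cdot\widehat n_h$, $\widehat{\mathcal H}_K=\{\widehat x\in\mathbb R^N:\widehat\ell_K(\widehat x)=0\}$. Standing assumption: $|x_K-x_{\Gamma_K}|+h_K|n_h-n(x_{\Gamma_K})|\le Ch_K^2$ for some $x_{\Gamma_K}\in\Gamma_K$; $\widehat\Gamma_K$ meets each edge of $\widehat K$ at most once; and, with $\mathcal I_K^+=\widehat{\mathcal N}\cap\widehat K^+$, $\mathcal I_K^-=\widehat{\mathcal N}\setminus\mathcal I_K^+$, $\mathcal I_{h,K}^+=\{\widehat A\in\widehat{\mathcal N}:\widehat\ell_K(\widehat A)\ge0\}$, $\mathcal I_{h,K}^-=\widehat{\mathcal N}\setminus\mathcal I_{h,K}^+$, one has $\mathcal I_K^s=\mathcal I_{h,K}^s\neq\emptyset$ for $s\in\{+,-\}$. Coefficients: $\mathbb B$ is a symmetric positive definite matrix function with $\mathbb B^\pm=\mathbb B|_{\Omega^\pm}$ having entries in $C^1(\overline{\Omega^\pm})$ and $\beta_{\min}^\pm|y|^2\le y^\top\mathbb B^\pm(x)y\le\beta_{\max}^\pm|y|^2$ for all $y\in\mathbb R^N$, $x\in\Omega^\pm$, with positive constants $\beta^\pm_{\min},\beta^\pm_{\max}$.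 Choose arbitrary points $x_{K^\pm}\in K^\pm$, put $\widehat{\mathbb B}_h^\pm=\mathbb B^\pm(x_{K^\pm})$ and $\widehat{\mathcal B}_h^\pm(\widehat x)=J_K^{-1}(\widehat x)\widehat{\mathbb B}_h^\pm J_K^{-\top}(\widehat x)$. For $\widehat v^\pm\in Q_1(\widehat K)$ write $[\![\widehat v^\pm]\!]=\widehat v^+-\widehat v^-$ (similarly for vector or matrix quantities), let $c_{\bm\alpha}(\widehat v)$ be the coefficient of the monomial $\widehat x^{\bm\alpha}$ in $\widehat v$, and $\mathcal A_N=\{\bm\alpha\in\{0,1\}^N:|\bm\alpha|\ge2\}$. The local reference IFE space $\widehat V_K^{\rm IFE}(\widehat K)$ consists of all $\widehat v$ with $\widehat v|_{\widehat K^\pm}=\widehat v^\pm$, $\widehat v^\pm\in Q_1(\widehat K)$, such that (i) $[\![\widehat v^\pm]\!]=0$ on $\widehat{\mathcal H}_K$; (ii) $[\![\widehat{\mathcal B}_h^\pm\widehat\nabla\widehat v^\pm\cdot\widehat n_h]\!](\widehat M_K)=0$; (iii) $[\![c_{\bm\alpha}(\widehat v^\pm)]\!]=0$ for all $\bm\alpha\in\mathcal A_N$. Selection of $\widehat M_K$: let $S=\operatorname{diag}(s_1,\dots,s_N)$ with $s_i=1$ if $(\widehat n_h)_i\ge0$ and $s_i=-1$ otherwise, let $P$ be a permutation matrix, $G=PS$, $\widetilde n=G\widehat n_h$ (nonnegative components), $\widetilde\ell(\widetilde x)=\widehat\ell_K(G^{-1}\widetilde x)$, $\widetilde{\mathcal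 I}^+=G(\mathcal I_{h,K}^+)$. Set $\widehat M_K=G^{-1}\widetilde M$, where $\widetilde M$ is: for $N=2$: $(1,1)^\top$ if $|\mathcal I_{h,K}^+|=3$; $(-1,-1)^\top$ if $|\mathcal I_{h,K}^+|=1$; if $|\mathcal I_{h,K}^+|=2$, $P$ is chosen so that $\widetilde{\mathcal I}^+=\{(1,-1)^\top,(1,1)^\top\}$ and $\widetilde M=(\delta/\widetilde n_1-1,-1)^\top$ with $\delta=\widetilde\ell(1,-1)$. For $N=3$: $(1,1,1)^\top$ if $|\mathcal I_{h,K}^+|\ge5$ or if $\widetilde{\mathcal I}^+=\{(1,1,-1)^\top,(1,-1,1)^\top,(-1,1,1)^\top,(1,1,1)^\top\}$; $(-1,-1,-1)^\top$ if $|\mathcal I_{h,K}^+|\le3$; in the remaining case ($|\mathcal I_{h,K}^+|=4$, $\mathcal I_{h,K}^+$ the vertices of a face) $P$ is chosen so that $\widetilde{\mathcal I}^+$ is the vertex set of the face $\widetilde x_1=1$ and $\widetilde M=(\delta/\widetilde n_1-1,-1,-1)^\top$ with $\delta=\widetilde\ell(1,-1,-1)$. (This selection is made so that $\widehat M_K\in\widehat K$ and $(\widehat\nabla\widehat\Pi\widehat w)(\widehat M_K)=\lambda\widehat n_h$ with $\lambda\in[0,1]$, where $\widehat\Pi$ is nodal $Q_1$ interpolation on $\widehat K$, $\widehat w=\widehat\ell_K$ on $\widehat K^+$ and $\widehat w=0$ on $\widehat K^-$.) *)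

(* Defs.v *)
From HB Require Import structures.
From mathcomp Require Import all_boot all_order all_algebra.
From mathcomp Require Import all_classical all_reals all_analysis.

Set Implicit Arguments.
Unset Strict Implicit.
Unset Printing Implicit Defensive.

Import Order.TTheory GRing.Theory Num.Theory.
Import numFieldNormedType.Exports.

Local Open Scope card_scope.
Local Open Scope classical_set_scope.
Local Open Scope ring_scope.

Section EuclideanSpace.
Context {R : realType} {N : nat}.
Local Notation V := 'cV[R]_N.

Definition dot (u v : V) : R := \sum_(i < N) u i 0 * v i 0.

(* The library norm `|x| on matrices is the sup norm, hence this one. *)
Definition enorm (u : V) : R := Num.sqrt (dot u u).

Definition diam (A : set V) : R :=
  sup [set r | exists x y, [/\ A x, A y & r = enorm (x - y)]].

Definition basis_vec (i : 'I_N) : V := delta_mx i 0.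

Definition colvec (s : seq R) : V := \col_i s`_i.

Definition grad (g : V -> R) (x : V) : V := \col_i 'D_(basis_vec i) g x.

(* C^1 and C^2 on an open set, through continuity of partial derivatives. *)
Definition C1_on (U : set V) (g : V -> R) : Prop :=
  forall i x, U x ->
    derivable g x (basis_vec i) /\ {for x, continuous ('D_(basis_vec i) g)}.

Definition C2_on (U : set V) (g : V -> R) : Prop :=
  C1_on U g /\ forall i, C1_on U ('D_(basis_vec i) g).

(* f, restricted to A, belongs to C^1(closure A): f|A and the partial
   derivatives of f in the interior of A extend continuously to closure A. *)
Definition C1_closure (A : set V) (f : V -> R) : Prop :=
  exists (g : V -> R) (dg : 'I_N -> V -> R),
    [/\ {within closure A, continuous g},
        forall i, {within closure A, continuous (dg i)},
        forall x, A x -> g x = f x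
      & forall i x, interior A x ->
          derivable f x (basis_vec i) /\ 'D_(basis_vec i) f x = dg i x].

End EuclideanSpace.

Section Q1.
Context {R : realType} {N : nat}.
Local Notation V := 'cV[R]_N.

(* Multi-indices alpha in {0,1}^N. *)
Definition mindex := {ffun 'I_N -> bool}.

Definition mdeg (al : mindex) : nat := \sum_(i < N) al i.

(* Q_1 = span {x^alpha : alpha in {0,1}^N}; an element is given by its
   coefficients, so that c_alpha(v) is just v alpha. *)
Definition Q1 := {ffun mindex -> R}.

Definition q1eval (v : Q1) (x : V) : R :=
  \sum_(al : mindex) v al * \prod_(i < N) x i 0 ^+ al i.

Definition Khat : set V := [set x | forall i, -1 <= x i 0 <= 1].

Definition vertices : set V := [set x | forall i, x i 0 = -1 \/ x i 0 = 1].

(* The face of Khat through the vertex a on which the coordinates in J are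
   frozen; it is proper as soon as J is not empty. *)
Definition face (J : pred 'I_N) (a : V) : set V :=
  Khat `&` [set x | forall j, J j -> x j 0 = a j 0].

Definition is_edge (e : set V) : Prop :=
  exists i a, vertices a /\ e = face (predC1 i) a.

(* An element is given by F_K in (Q_1)^N; the cell is K = F_K(Khat). *)
Definition element := 'I_N -> Q1.

Definition F (E : element) (x : V) : V := \col_i q1eval (E i) x.

Definition cell (E : element) : set V := F E @` Khat.

Definition jac (E : element) (x : V) : 'M[R]_N :=
  \matrix_(i, j) 'D_(basis_vec j) (q1eval (E i)) x.

Definition pull (E : element) (A : set V) : set V := Khat `&` F E @^-1` A.

Definition Finv (E : element) : V -> V := 'pinv_(fun=> 0) Khat (F E).

Record conforming_mesh (Omega : set V) (T : set element) : Prop := {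
  mesh_finite : finite_set T;
  mesh_inj : forall E, T E -> {in Khat &, injective (F E)};
  mesh_det : forall E, T E -> forall x, Khat x -> 0 < \det (jac E x);
  mesh_cover : \bigcup_(E in T) cell E = Omega;
  mesh_conf : forall E E', T E -> T E' -> E <> E' ->
    cell E `&` cell E' = set0 \/
    exists (J J' : pred 'I_N) (a a' : V),
      [/\ (exists j, J j) /\ vertices a, (exists j, J' j) /\ vertices a',
          F E @` face J a = cell E `&` cell E'
        & F E' @` face J' a' = cell E `&` cell E'] }.

End Q1.

Arguments mindex : clear implicits.
Arguments Q1 : clear implicits.
Arguments element : clear implicits.
Arguments Khat : clear implicits.
Arguments vertices : clear implicits.

Section Interface.
Context {R : realType} {N : nat}.
Local Notation V := 'cV[R]_N.

Definition defining_function (Gamma : set V) (z : V) (U : set V) (g : V -> R) :=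
  [/\ open U, U z, C2_on U g, (forall x, U x -> grad g x <> 0)
    & Gamma `&` U = [set x | U x /\ g x = 0]].

(* Convention: Omega is the closed polytope, Gamma lies in its interior, and
   Omega^-, Omega^+ contain their share of the boundary of Omega.  Thus
   T = (T `&` Om) `|` (T `&` Op) also for the closed cells which touch that
   boundary. *)
Record interface_domain (Omega Gamma Om Op : set V) (nu : V -> V) : Prop := {
  dom_polytope : exists (m : nat) (a : 'I_m -> V) (b : 'I_m -> R),
    Omega = [set x | forall i, dot (a i) x <= b i];
  dom_bounded : bounded_set Omega;
  dom_interior : interior Omega !=set0;
  Gamma_sub : Gamma `<=` interior Omega;
  Gamma_neq0 : Gamma !=set0;
  Gamma_compact : compact Gamma;
  Gamma_C2 : forall z, Gamma z -> exists U g, defining_function Gamma z U g;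
  dom_split : Omega `\` Gamma = Om `|` (Op `\` Gamma);
  Gamma_plus : Gamma `<=` Op;
  dom_separated : separated Om (Op `\` Gamma);
  minus_neq0 : Om !=set0;
  plus_neq0 : Op `\` Gamma !=set0;
  minus_connected : connected Om;
  plus_connected : connected (Op `\` Gamma);
  normal_unit : forall z, Gamma z -> enorm (nu z) = 1;
  normal_orth : forall z U g, Gamma z -> defining_function Gamma z U g ->
    exists k : R, nu z = k *: grad g z;
  normal_plus : forall z, Gamma z ->
    exists2 e : R, 0 < e & forall t, 0 < t < e -> Op (z + t *: nu z) }.

Definition interface_element (Gamma : set V) (E : element R N) : Prop :=
  Gamma `&` interior (cell E) !=set0.

(* The admissible coefficients on the side A of the interface. *)
Record coefficient (A : set V) (B : V -> 'M[R]_N) (bmin bmax : R) : Prop := {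
  coef_sym : forall x, A x -> (B x)^T = B x;
  coef_C1 : forall i j, C1_closure A (fun x => B x i j);
  coef_bmin : 0 < bmin;
  coef_bmax : 0 < bmax;
  coef_bounds : forall x y, A x ->
    bmin * enorm y ^+ 2 <= dot y (B x *m y) <= bmax * enorm y ^+ 2 }.

Definition xhat (E : element R N) (xK : V) : V := Finv E xK.

Definition nhat (E : element R N) (xK nh : V) : V :=
  let w := (jac E (xhat E xK))^T *m nh in (enorm w)^-1 *: w.

Definition ellhat (E : element R N) (xK nh x : V) : R :=
  dot (x - xhat E xK) (nhat E xK nh).

Definition Hhat (E : element R N) (xK nh : V) : set V :=
  [set x | ellhat E xK nh x = 0].

Definition I_plus (Op : set V) (E : element R N) : set V :=
  vertices R N `&` pull E (cell E `&` Op).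

Definition I_minus (Op : set V) (E : element R N) : set V :=
  vertices R N `\` I_plus Op E.

Definition Ih_plus (ell : V -> R) : set V :=
  vertices R N `&` [set x | 0 <= ell x].

Definition Ih_minus (ell : V -> R) : set V := vertices R N `\` Ih_plus ell.

(* C is uniform over the whole family of meshes; xs and ns are the choices of
   x_K and n_h on each mesh. *)
Definition standing_assumption (Gamma Op : set V) (nu : V -> V)
    (mesh : R -> set (element R N)) (xs ns : R -> element R N -> V) (C : R) :=
  forall h E, 0 < h -> mesh h E -> interface_element Gamma E ->
  let K := cell E in
  let ell := ellhat E (xs h E) (ns h E) in
  [/\ K (xs h E) /\ enorm (ns h E) = 1,
      (exists2 xG, (Gamma `&` K) xG &
         enorm (xs h E - xG) + diam K * enorm (ns h E - nu xG)
           <= C * diam K ^+ 2),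
      (forall e x y, is_edge e -> e x -> e y ->
         pull E (Gamma `&` K) x -> pull E (Gamma `&` K) y -> x = y),
      I_plus Op E = Ih_plus ell /\ Ih_plus ell !=set0
    & I_minus Op E = Ih_minus ell /\ Ih_minus ell !=set0].

Definition Bcal (E : element R N) (Bs : 'M[R]_N) (x : V) : 'M[R]_N :=
  invmx (jac E x) *m Bs *m (invmx (jac E x))^T.

(* The local reference IFE space, as a set of functions on Khat.  Bp and Bm
   are the constant matrices B^+(x_{K^+}) and B^-(x_{K^-}). *)
Definition V_IFE (Om Op : set V) (E : element R N) (xK nh : V)
    (Bp Bm : 'M[R]_N) (M : V) : set (Khat R N -> R) :=
  [set v | exists vp vm : Q1 R N,
    [/\ forall x : Khat R N, pull E (cell E `&` Op) (val x) ->
          v x = q1eval vp (val x),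
        forall x : Khat R N, pull E (cell E `&` Om) (val x) ->
          v x = q1eval vm (val x),
        forall x, Hhat E xK nh x -> q1eval vp x - q1eval vm x = 0,
        dot (Bcal E Bp M *m grad (q1eval vp) M) (nhat E xK nh)
          - dot (Bcal E Bm M *m grad (q1eval vm) M) (nhat E xK nh) = 0
      & forall al : mindex N, (2 <= mdeg al)%N -> vp al - vm al = 0]].

End Interface.

Section FluxPoint.
Context {R : realType} {d : nat}.
Local Notation N := d.+1.
Local Notation V := 'cV[R]_N.

Definition sign_mx (n : V) : 'M[R]_N :=
  diag_mx (\row_i if 0 <= n i 0 then 1 else -1).

(* M is a point obtained by the selection rule, for some permutation matrix P
   meeting the requirements of the rule. *)
Definition flux_point (ell : V -> R) (n M : V) : Prop :=
  exists (P : 'M[R]_N) (Mt : V),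
  let G := P *m sign_mx n in
  let nt := G *m n in
  let ellt := fun y => ell (invmx G *m y) in
  let I := Ih_plus ell in
  let It := [set G *m x | x in I] in
  let star := [set colvec [:: 1; 1; -1]; colvec [:: 1; -1; 1];
                   colvec [:: -1; 1; 1]; colvec [:: 1; 1; 1]] in
  [/\ is_perm_mx P, M = invmx G *m Mt
    & (N = 2%N /\
        [\/ I #= `I_3 /\ Mt = colvec [:: 1; 1],
            I #= `I_1 /\ Mt = colvec [:: -1; -1]
          | [/\ I #= `I_2,
                It = [set colvec [:: 1; -1]; colvec [:: 1; 1]]
              & let delta := ellt (colvec [:: 1; -1]) in
                Mt = colvec [:: delta / nt 0 0 - 1; -1]]])
      \/
      (N = 3%N /\
        [\/ (`I_5 #<= I \/ It = star) /\ Mt = colvec [:: 1; 1; 1],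
            I #<= `I_3 /\ Mt = colvec [:: -1; -1; -1]
          | [/\ I #= `I_4,
                It = vertices R N `&` [set x | x 0 0 = 1]
              & let delta := ellt (colvec [:: 1; -1; -1]) in
                Mt = colvec [:: delta / nt 0 0 - 1; -1; -1]]])].

End FluxPoint.

(* Main.v *)
(* The jump v^+ - v^- of an IFE function is affine and vanishes on the line or
   plane {ell = 0}, hence equals a * ell for a scalar a.  If u interpolates the
   prescribed nodal values and w interpolates max(ell, 0), then necessarily
   v^- = u - a w and v^+ = v^- + a ell.  The flux condition at M becomes a scalar
   equation for a, and since grad w (M) = lam * n with 0 <= lam <= 1, the
   coefficient of a is the convex combination
   (1 - lam) B^+ n.n + lam B^- n.n > 0. *)
Require Import Defs.
From HB Require Import structures.
From mathcomp Require Import all_boot all_order all_algebra.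
From mathcomp Require Import all_classical all_reals all_analysis.
From mathcomp Require Import perm ring lra.

Set Implicit Arguments.
Unset Strict Implicit.
Unset Printing Implicit Defensive.

Import Order.TTheory GRing.Theory Num.Theory.
Import numFieldNormedType.Exports.

Local Open Scope card_scope.
Local Open Scope classical_set_scope.
Local Open Scope ring_scope.

(** * Euclidean inner product and normalisation *)

Section Dot.
Context {R : realType} {N : nat}.
Implicit Types (u v w : 'cV[R]_N) (a : R).

Lemma dotC u v : dot u v = dot v u.
Proof. by apply: eq_bigr => i _; rewrite mulrC. Qed.

Lemma dotDl u v w : dot (u + v) w = dot u w + dot v w.
Proof. by rewrite -big_split; apply: eq_bigr => i _; rewrite !mxE mulrDl. Qed.

Lemma dotZl a u w : dot (a *: u) w = a * dot u w.
Proof. by rewrite [RHS]big_distrr; apply: eq_bigr => i _; rewrite !mxE /= mulrA. Qed.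

Lemma dotBl u v w : dot (u - v) w = dot u w - dot v w.
Proof. by rewrite dotDl -scaleN1r dotZl mulN1r. Qed.

Lemma dot_mul_tr (X : 'M[R]_N) u v : dot (X *m u) v = dot u (X^T *m v).
Proof.
have dE x y : dot x y = (x^T *m y) 0 0.
  by rewrite mxE; apply: eq_bigr => i _; rewrite mxE.
by rewrite !dE trmx_mul mulmxA.
Qed.

Lemma dot_ge0 u : 0 <= dot u u.
Proof. by apply: sumr_ge0 => i _; rewrite -expr2 sqr_ge0. Qed.

Lemma enorm_sqr u : enorm u ^+ 2 = dot u u.
Proof. by rewrite sqr_sqrtr // dot_ge0. Qed.

Lemma dot_gt0 u : u != 0 -> 0 < dot u u.
Proof.
move=> u0; rewrite lt_def dot_ge0 andbT; apply: contra_neq u0 => /eqP.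
rewrite psumr_eq0 => [|i _]; last by rewrite -expr2 sqr_ge0.
move=> /allP h; apply/colP => i; apply/eqP.
by have := h i (mem_index_enum i); rewrite mulf_eq0 orbb mxE.
Qed.

Lemma dot_normalized u : u != 0 ->
  dot ((enorm u)^-1 *: u) ((enorm u)^-1 *: u) = 1.
Proof.
move=> u0; rewrite dotZl dotC dotZl mulrA -expr2 exprVn enorm_sqr mulVf //.
by rewrite gt_eqF ?dot_gt0.
Qed.

End Dot.

(** * Nodal interpolation in [Q1] and partial derivatives through nodal values *)

Section Interpolation.
Context {R : realType} {N : nat}.
Local Notation V := 'cV[R]_N.
Implicit Types (q : Q1 R N) (x y : V) (a al : mindex N) (i j : 'I_N).

Definition monomial al x : R := \prod_i x i 0 ^+ al i.

Lemma q1evalD q r x : q1eval (q + r) x = q1eval q x + q1eval r x.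
Proof. by rewrite -big_split; apply: eq_bigr => al _; rewrite ffunE mulrDl. Qed.

Lemma q1evalZ (t : R) q x : q1eval (t *: q) x = t * q1eval q x.
Proof. by rewrite [RHS]big_distrr; apply: eq_bigr => al _; rewrite ffunE /= mulrA. Qed.

Lemma q1evalB q r x : q1eval (q - r) x = q1eval q x - q1eval r x.
Proof. by rewrite q1evalD -scaleN1r q1evalZ mulN1r. Qed.

Definition sgn (b : bool) : R := if b then 1 else -1.

Definition vtx a : V := \col_i sgn (a i).

Lemma eqN11 : (-1 == 1 :> R) = false.
Proof. by apply: lt_eqF; lra. Qed.

Lemma vtx_vertex a : vertices R N (vtx a).
Proof. by move=> i; rewrite mxE; case: (a i); [right|left]. Qed.

Lemma vertexE x : vertices R N x -> exists a, x = vtx a.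
Proof.
move=> vx; exists [ffun i => x i 0 == 1]; apply/colP => i; rewrite mxE ffunE.
by case: (vx i) => ->; rewrite ?eqxx ?eqN11.
Qed.

Lemma vtx_inj : injective vtx.
Proof.
move=> a b /colP ab; apply/ffunP => i; have := ab i; rewrite !mxE.
by case: (a i) (b i) => [] [] // /eqP; rewrite /sgn ?eqN11 // eq_sym eqN11.
Qed.

Definition lagrange a x : R := \prod_i ((1 + sgn (a i) * x i 0) / 2).

Lemma lagrange_vtx a b : lagrange a (vtx b) = (a == b)%:R.
Proof.
case: eqVneq => [->|ab].
  rewrite /lagrange big1 // => i _; rewrite mxE /sgn; case: (b i); lra.
have [i abi] : exists i, a i != b i.
  apply/existsP; apply: contraNT ab; rewrite negb_exists => /forallP h.
  by apply/eqP/ffunP => i; apply/eqP; have := h i; rewrite negbK.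
have -> : lagrange a (vtx b) = 0; last by [].
have s0 : 1 + sgn (a i) * sgn (b i) = 0.
  by move: abi; rewrite /sgn; case: (a i); case: (b i) => //= _; ring.
by rewrite /lagrange (bigD1 i) //= mxE s0 !mul0r.
Qed.

(** In one variable, [1] and [t] are reproduced by linear interpolation at [-1] and [1]. Multiplying
    these identities over the coordinates and expanding over all sign choices reproduces every
    monomial, hence every element of [Q1]. *)
Lemma q1eval_lagrange q x :
  q1eval q x = \sum_a q1eval q (vtx a) * lagrange a x.
Proof.
transitivity (\sum_al \sum_a q al * (monomial al (vtx a) * lagrange a x)).
  apply: eq_bigr => al _; rewrite -big_distrr /=; congr (_ * _).
  transitivity (\prod_i \sum_(b : bool) sgn b ^+ al i * ((1 + sgn b * x i 0) / 2)).
    by apply: eq_bigr => i _; rewrite big_bool /sgn; case: (al i) => /=; field.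
  rewrite bigA_distr_bigA; apply: eq_bigr => a _.
  by rewrite big_split; congr (_ * _); apply: eq_bigr => i _; rewrite mxE.
rewrite exchange_big; apply: eq_bigr => a _; rewrite big_distrl /=.
by apply: eq_bigr => al _; rewrite mulrA.
Qed.

Lemma q1eval_eq q r :
  (forall x, vertices R N x -> q1eval q x = q1eval r x) ->
  q1eval q = q1eval r.
Proof.
move=> qr; apply/funext => x; rewrite !q1eval_lagrange.
by apply: eq_bigr => a _; rewrite qr //; exact: vtx_vertex.
Qed.

(** The coefficients come from expanding the product of the factors [(1 + sgn (a i) * x i 0) / 2]:
    the coefficient of a monomial in the nodal function at [vtx a] is [2^-1 ^+ N] times the value of
    that monomial at [vtx a]. *)
Lemma q1_interpolation (f : V -> R) :
  exists q, forall x, vertices R N x -> q1eval q x = f x.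
Proof.
pose q : Q1 R N := \sum_a [ffun al => f (vtx a) * (2^-1 ^+ N * monomial al (vtx a))].
suff qE x : q1eval q x = \sum_a f (vtx a) * lagrange a x.
  exists q => _ /vertexE[b ->]; rewrite qE (bigD1 b) //= lagrange_vtx eqxx mulr1.
  by rewrite big1 ?addr0 // => a /negPf ab; rewrite lagrange_vtx ab mulr0.
have -> : q1eval q x = \sum_al \sum_a
    f (vtx a) * (2^-1 ^+ N * monomial al (vtx a)) * monomial al x.
  apply: eq_bigr => al _; rewrite sum_ffunE big_distrl /=.
  by apply: eq_bigr => a _; rewrite ffunE.
rewrite exchange_big; apply: eq_bigr => a _.
transitivity (f (vtx a) * (2^-1 ^+ N * \sum_al monomial al (vtx a) * monomial al x)).
  by rewrite !big_distrr; apply: eq_bigr => al _; rewrite /= !mulrA.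
congr (_ * _).
transitivity (\prod_i (2^-1 * \sum_(b : bool) (sgn (a i) * x i 0) ^+ b)).
  rewrite big_split prodr_const card_ord; congr (_ * _).
  rewrite bigA_distr_bigA; apply: eq_bigr => al _.
  by rewrite -big_split; apply: eq_bigr => i _; rewrite mxE exprMn.
by apply: eq_bigr => i _; rewrite big_bool /=; field.
Qed.

Definition upd x i (t : R) : V := \col_j if j == i then t else x j 0.

Lemma upd_id x i : upd x i (x i 0) = x.
Proof. by apply/colP => j; rewrite mxE; case: eqP => // ->. Qed.

Lemma upd_upd x i s t : upd (upd x i s) i t = upd x i t.
Proof. by apply/colP => j; rewrite !mxE; case: eqP. Qed.

Lemma vertices_upd x i t : vertices R N x -> t = -1 \/ t = 1 ->
  vertices R N (upd x i t).
Proof. by move=> vx vt j; rewrite mxE; case: ifP. Qed.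

Lemma q1_affine q x i t :
  q1eval q (upd x i t) =
  (1 + t) / 2 * q1eval q (upd x i 1) + (1 - t) / 2 * q1eval q (upd x i (-1)).
Proof.
rewrite /q1eval !big_distrr -big_split; apply: eq_bigr => al _ /=.
have updE s : \prod_j upd x i s j 0 ^+ al j =
    s ^+ al i * \prod_(j | j != i) x j 0 ^+ al j.
  rewrite (bigD1 i) //= mxE eqxx; congr (_ * _).
  by apply: eq_bigr => j /negPf ji; rewrite mxE ji.
by rewrite !updE; case: (al i) => /=; field.
Qed.

(** Along a coordinate line [q] is affine, so the difference quotient is constant and equals the
    slope between the two opposite faces. Gradients thereby reduce to values of [q]. *)
Lemma derive_q1 q x i :
  'D_(basis_vec i) (q1eval q) x =
  (q1eval q (upd x i 1) - q1eval q (upd x i (-1))) / 2.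
Proof.
apply/cvg_lim => //; apply: cvg_near_cst; near=> t.
have t0 : t != 0 by near: t; exact: nbhs_dnbhs_neq.
rewrite /=; have -> : t *: basis_vec i + x = upd x i (x i 0 + t).
  apply/colP => j; rewrite !mxE eqxx andbT.
  by case: eqP => [->|_]; rewrite ?mulr1 ?mulr0 ?add0r // addrC.
rewrite -[in q1eval q x](upd_id x i) (q1_affine q x i (x i 0 + t)).
rewrite (q1_affine q x i (x i 0)); move: (x i 0) (q1eval _ _) (q1eval _ _).
by move=> s a b; rewrite -[_ *: _]/(_ * _ : R); field.
Unshelve. all: by end_near. Qed.

Lemma gradD q r x : grad (q1eval (q + r)) x = grad (q1eval q) x + grad (q1eval r) x.
Proof. by apply/colP => i; rewrite !mxE !derive_q1 !q1evalD; field. Qed.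

Lemma gradZ (t : R) q x : grad (q1eval (t *: q)) x = t *: grad (q1eval q) x.
Proof. by apply/colP => i; rewrite !mxE !derive_q1 !q1evalZ; field. Qed.

Lemma gradB q r x : grad (q1eval (q - r)) x = grad (q1eval q) x - grad (q1eval r) x.
Proof. by rewrite gradD -scaleN1r gradZ scaleN1r. Qed.

End Interpolation.

(** * Elements of [Q1] without mixed terms *)

Section Affine.
Context {R : realType} {N : nat}.
Local Notation V := 'cV[R]_N.
Implicit Types (q : Q1 R N) (x y n : V).

Lemma monomial_affine (al : mindex N) : (mdeg al < 2)%N ->
  (forall x, monomial al x = 1) \/ exists i, forall x, monomial al x = x i 0.
Proof.
move=> al2; have [/existsP[i ali]|/existsPn al0] := boolP [exists i, al i]; last first.
  left=> x; rewrite /monomial big1 // => i _.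
  by rewrite (negPf (al0 i)).
right; exists i => x; rewrite /monomial (bigD1 i) //= ali expr1 big1 ?mulr1 // => j ji.
case: (boolP (al j)) => // alj; move: al2.
by rewrite /mdeg (bigD1 i) //= (bigD1 j) //= ali alj.
Qed.

Lemma q1eval_affine q : (forall al, (2 <= mdeg al)%N -> q al = 0) ->
  forall x y (t : R), q1eval q (x + t *: y) = q1eval q x + t * (q1eval q y - q1eval q 0).
Proof.
move=> q0 x y t; rewrite /q1eval -sumrB big_distrr -big_split.
apply: eq_bigr => al _ /=; rewrite -!/(monomial al _).
have [/q0->|/monomial_affine[mE|[i mE]]] := leqP 2 (mdeg al); first ring.
  by rewrite !mE; ring.
by rewrite !mE !mxE; ring.
Qed.

(** Each [x] is its orthogonal projection on the hyperplane plus a multiple of [n]. An affine [q] is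
    zero at the projection, so only its slope along [n] remains, and that slope is [a]. Applied to
    the jump of an IFE function. *)
Lemma q1_vanishing_on_hyperplane q x0 n :
  (forall al, (2 <= mdeg al)%N -> q al = 0) -> dot n n = 1 ->
  (forall x, dot (x - x0) n = 0 -> q1eval q x = 0) ->
  exists a, forall x, q1eval q x = a * dot (x - x0) n.
Proof.
move=> q0 n1 qH; exists (q1eval q n - q1eval q 0) => x.
set t := dot (x - x0) n; have q_foot : q1eval q (x - t *: n) = 0.
  by apply: qH; rewrite addrAC dotBl dotZl n1 mulr1 subrr.
have -> : q1eval q x = q1eval q ((x - t *: n) + t *: n) by rewrite subrK.
by rewrite q1eval_affine // q_foot add0r mulrC.
Qed.

Lemma q1_distance x0 n : exists2 q : Q1 R N,
  forall x, q1eval q x = dot (x - x0) n & forall al, (2 <= mdeg al)%N -> q al = 0.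
Proof.
(* [m0] indexes the constant monomial and [m1 i] the coordinate [x i 0]. *)
pose m0 : mindex N := [ffun=> false]; pose m1 i : mindex N := [ffun j => j == i].
exists [ffun al => - dot x0 n * (al == m0)%:R + \sum_i n i 0 * (al == m1 i)%:R] => [x|al al2].
  have single c m : \sum_al c * (al == m)%:R * monomial al x = c * monomial m x.
    rewrite (bigD1 m) //= eqxx mulr1 big1 ?addr0 // => al /negPf ->.
    by rewrite mulr0 mul0r.
  under [LHS]eq_bigr => al _ do rewrite ffunE mulrDl big_distrl /=.
  rewrite big_split /= exchange_big single /=.
  under [X in _ + X]eq_bigr => i _ do rewrite single.
  rewrite dotBl addrC; congr (_ + _).
    apply: eq_bigr => i _; rewrite mulrC; congr (_ * _).
    rewrite /monomial (bigD1 i) //= ffunE eqxx big1 ?mulr1 // => j /negPf ji.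
    by rewrite ffunE ji.
  by rewrite /monomial big1 ?mulr1 // => i _; rewrite ffunE.
have mne m : (mdeg m < 2)%N -> (al == m) = false.
  by move=> m2; apply: contraTF al2 => /eqP->; rewrite -ltnNge.
rewrite ffunE mne ?mulr0 ?add0r; last by rewrite /mdeg big1 // => i _; rewrite ffunE.
rewrite big1 // => i _; rewrite mne ?mulr0 //.
rewrite /mdeg (bigD1 i) //= ffunE eqxx big1 // => j /negPf ji.
by rewrite ffunE ji.
Qed.

Lemma dot_upd x x0 n i t :
  dot (upd x i t - x0) n = dot (x - x0) n + (t - x i 0) * n i 0.
Proof.
rewrite /dot (bigD1 i) //= (bigD1 i (F := fun j => (x - x0) j 0 * n j 0)) //=.
rewrite !mxE eqxx (eq_bigr (fun j => (x - x0) j 0 * n j 0)); first ring.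
by move=> j /negPf ji; rewrite !mxE ji.
Qed.

Lemma le_dot x y x0 n : (forall i, x i 0 * n i 0 <= y i 0 * n i 0) ->
  dot (x - x0) n <= dot (y - x0) n.
Proof.
by move=> xy; rewrite !dotBl lerD2r; apply: ler_sum => i _; exact: xy.
Qed.

End Affine.

(** * Points where the gradient of a nodal interpolant is parallel to [n] *)

Section NodalGradient.
Context {R : realType} {N : nat}.
Local Notation V := 'cV[R]_N.
Variables (x0 n : V).
Local Notation ell x := (dot (x - x0) n).

(** At a vertex, the partial derivatives involve only that vertex and its neighbours, so agreement
    with [c * ell] there suffices, whatever [w] does at the other vertices. *)
Lemma grad_corner (w : Q1 R N) (c : R) (x : V) :
  (forall i t, t = -1 \/ t = 1 -> q1eval w (upd x i t) = c * ell (upd x i t)) ->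
  grad (q1eval w) x = c *: n.
Proof.
move=> wE; apply/colP => i; rewrite !mxE derive_q1.
by rewrite !wE ?dot_upd; [field|left|right].
Qed.

(** At the fraction [th] of the way from the face where [w] is 0 to the face where it is [ell], [w]
    is [th] times [ell] on the latter, which gives the derivatives transverse to [j]. The derivative
    along [j] is fixed by the value of [ell] at the end of the edge; the last hypothesis makes it
    [th * n j 0] as well. *)
Lemma grad_edge (w : Q1 R N) (j : 'I_N) (s th : R) (x : V) :
  vertices R N x -> s = -1 \/ s = 1 ->
  (forall y, vertices R N y -> y j 0 = s -> q1eval w y = ell y) ->
  (forall y, vertices R N y -> y j 0 = - s -> q1eval w y = 0) ->
  ell (upd x j s) = 2 * th * (s * n j 0) ->
  grad (q1eval w) (upd x j (s * (2 * th - 1))) = th *: n.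
Proof.
move=> vx vs w1 w0 ellE.
have vu i t : t = -1 \/ t = 1 -> vertices R N (upd x i t) by exact: vertices_upd.
have vNs : - s = -1 \/ - s = 1 by case: vs => ->; rewrite ?opprK; [right|left].
have wedge y : vertices R N y ->
    q1eval w (upd y j (s * (2 * th - 1))) = th * ell (upd y j s).
  move=> vy; rewrite q1_affine.
  have q1 : q1eval w (upd y j s) = ell (upd y j s).
    by apply: w1; [exact: vertices_upd|rewrite mxE eqxx].
  have q0 : q1eval w (upd y j (- s)) = 0.
    by apply: w0; [exact: vertices_upd|rewrite mxE eqxx].
  by case: vs q1 q0 => -> q1; rewrite ?opprK => q0; rewrite q0 q1; field.
apply/colP => i; rewrite !mxE derive_q1.
have [->|ij] := eqVneq i j.
  rewrite !upd_upd.
  have q1 : q1eval w (upd x j s) = 2 * th * (s * n j 0).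
    by rewrite w1 ?ellE ?mxE ?eqxx //; exact: vertices_upd.
  have q0 : q1eval w (upd x j (- s)) = 0.
    by rewrite w0 ?mxE ?eqxx //; exact: vertices_upd.
  by case: vs q1 q0 => -> q1; rewrite ?opprK => q0; rewrite q0 q1; field.
have updC t u : upd (upd x j t) i u = upd (upd x i u) j t.
  by apply/colP => k; rewrite !mxE; case: eqP => // ->; rewrite (negPf ij).
rewrite !updC !wedge; [|exact: vu (or_introl _)|exact: vu (or_intror _)].
by rewrite -!updC !dot_upd; field.
Qed.

End NodalGradient.

(** * Counting the vertices of a face *)

Lemma card_finset {T : finType} (A : pred T) : [set x | A x] #= `I_#|A|.
Proof.
apply/card_set_bijP; exists (fun x => index x (enum A)); split.
- by move=> x /= Ax; rewrite cardE index_mem mem_enum.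
- move=> x y; rewrite !inE => Ax Ay exy.
  rewrite -(nth_index x (s := enum A) (x := x)) ?mem_enum // exy.
  by rewrite nth_index ?mem_enum.
- move=> k /= kA; have [x0 Ax0] : exists x0, A x0.
    apply/existsP; move: kA; apply: contraTT => /existsPn A0.
    suff -> : #|A| = 0%N by [].
    by apply: eq_card0 => x; rewrite [x \in A](negPf (A0 x)).
  have kA' : (k < size (enum A))%N by rewrite -cardE.
  exists (nth x0 (enum A) k); last by rewrite index_uniq ?enum_uniq.
  by rewrite /= -[A _]/(_ \in A) -mem_enum mem_nth.
Qed.

Lemma card_vertex_face {R : realType} (d : nat) (i : 'I_d.+1) (t : R) :
  t = -1 \/ t = 1 ->
  vertices R d.+1 `&` [set x | x i 0 = t] #= `I_(2 ^ d).
Proof.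
move=> vt; have [b tb] : exists b, t = sgn b.
  by case: vt => ->; [exists false|exists true].
pose A : pred (mindex d.+1) := fun a => a i == b.
have cardA : #|A| = (2 ^ d)%N.
  (* Flipping coordinate [i] exchanges the face with the opposite one, so each holds half of the
     vertices. *)
  have flip : #|predC A| = #|A|.
    pose f (a : mindex d.+1) : mindex d.+1 := [ffun j => (j == i) (+) a j].
    have fK : involutive f.
      by move=> a; apply/ffunP => j; rewrite !ffunE addbA addbb.
    rewrite -(fintype.card_image (inv_inj fK) (predC A)); apply: eq_card => a.
    rewrite -[a in LHS]fK fintype.mem_image; last exact: inv_inj.
    rewrite !inE -[a \in A]/(A a) /A !ffunE eqxx addTb.
    by case: (a i) (b) => [] [].
  have := cardC A; rewrite flip card_ffun card_bool card_ord expnS mul2n addnn.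
  exact: double_inj.
rewrite -cardA.
have -> : vertices R d.+1 `&` [set x | x i 0 = t] = vtx @` [set a | A a].
  apply/seteqP; split => [x [/vertexE[a ->]] /=|_ [a /eqP Aa <-]].
    by rewrite mxE tb => h; exists a => //; move: h; rewrite /A /sgn;
       case: (a i) (b) => [] [] // /eqP; rewrite ?eqN11 // eq_sym eqN11.
  by split; [exact: vtx_vertex|rewrite /= mxE Aa].
apply: card_eq_trans (card_finset A); apply: inj_card_eq => a a' _ _; exact: vtx_inj.
Qed.

(** * The three types of flux point: top corner, bottom corner, and a point on an edge *)

Section FluxPoint.
Context {R : realType} {d : nat}.
Local Notation N := d.+1.
Local Notation V := 'cV[R]_N.
Variables (x0 n : V).
Local Notation ell x := (dot (x - x0) n).
Local Notation I := (Ih_plus (fun x : V => ell x)).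

Let s i : R := sgn (0 <= n i 0).
(* The vertex where ell is largest on Khat; ell is smallest at - sv. *)
Let sv : V := \col_i s i.

Let s_sign i : s i = -1 \/ s i = 1.
Proof. by rewrite /s; case: (0 <= n i 0); [right|left]. Qed.

Let s2 i : s i * s i = 1.
Proof. by case: (s_sign i) => ->; rewrite ?mulrNN ?mulr1. Qed.

Let s_n i : 0 <= s i * n i 0.
Proof.
by rewrite /s /sgn; case: (leP 0 (n i 0)) => h; rewrite ?mul1r // mulN1r oppr_ge0 ltW.
Qed.

Let sign_n (t : R) i : t = -1 \/ t = 1 -> - (s i * n i 0) <= t * n i 0 <= s i * n i 0.
Proof.
have := s_n i; case: (s_sign i) => -> h [] ->; lra.
Qed.

Let vsv : vertices R N sv.
Proof. by move=> i; rewrite mxE. Qed.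
Let vNsv : vertices R N (- sv).
Proof.
by move=> i; rewrite !mxE; case: (s_sign i) => ->; rewrite ?opprK; [right|left].
Qed.

(* If ell is negative at a neighbour of sv, it is negative on the whole opposite
   face, so that I lies in a single face. *)
Lemma corner_plus : ~ (I #<= `I_(2 ^ d)) ->
  forall i t, t = -1 \/ t = 1 -> 0 <= ell (upd sv i t).
Proof.
move=> cI i; suff m : 0 <= ell (upd sv i (- s i)).
  move=> t vt; apply: le_trans m _; rewrite !dot_upd lerD2l !mulrBl lerD2r.
  by rewrite mulNr; have /andP[] := sign_n i vt.
rewrite leNgt; apply/negP => neg; apply: cI.
rewrite -(card_le_eqr (card_vertex_face i (s_sign i))).
apply: subset_card_le => x [vx /= xI]; split => //=.
have [//|xi] : x i 0 = s i \/ x i 0 = - s i.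
  by case: (vx i) (s_sign i) => -> [] ->; rewrite ?opprK; tauto.
have : ell x <= ell (upd sv i (- s i)).
  apply: le_dot => j; rewrite mxE; case: eqP => [->|_]; first by rewrite xi.
  by rewrite mxE; have /andP[] := sign_n j (vx j).
by rewrite leNgt (lt_le_trans neg xI).
Qed.

(** Mirror image of the previous argument: if [ell] is nonnegative at a neighbour of [- sv], it is
    so on the whole face through that neighbour opposite to [- sv], and [I] contains [2 ^ d]
    vertices. *)
Lemma corner_minus : ~ (`I_(2 ^ d) #<= I) ->
  forall i t, t = -1 \/ t = 1 -> ell (upd (- sv) i t) < 0.
Proof.
move=> cI i; suff m : ell (upd (- sv) i (s i)) < 0.
  move=> t vt; apply: le_lt_trans m; rewrite !dot_upd lerD2l !mulrBl lerD2r.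
  by have /andP[] := sign_n i vt.
rewrite ltNge; apply/negP => pos; apply: cI.
rewrite -(card_le_eql (card_vertex_face i (s_sign i))).
apply: subset_card_le => x [vx /= xi]; split => //=.
apply: le_trans pos _; apply: le_dot => j; rewrite !mxE.
case: eqP => [->|_]; first by rewrite xi.
by rewrite mulNr; have /andP[] := sign_n j (vx j).
Qed.

Section Cases.
Variable w : Q1 R N.
Hypothesis wE : forall x, vertices R N x ->
  q1eval w x = if 0 <= ell x then ell x else 0.

Let nodal_gradient_ok M := Khat R N M /\
  exists2 lam : R, 0 <= lam <= 1 & grad (q1eval w) M = lam *: n.

(** When [sv] and all its neighbours lie in [I], [w] agrees with [ell] at them and [lam] is 1. The
    second alternative serves the configuration in dimension three with exactly four vertices, where
    counting does not decide. *)
Lemma nodal_gradient_plus : ~ (I #<= `I_(2 ^ d)) \/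
    (forall i t, t = -1 \/ t = 1 -> 0 <= ell (upd sv i t)) -> nodal_gradient_ok sv.
Proof.
move=> h; have {}h i t : t = -1 \/ t = 1 -> 0 <= ell (upd sv i t).
  by case: h => [/corner_plus|]; exact.
split; first by move=> i; rewrite mxE; case: (s_sign i) => ->; lra.
exists 1; first by rewrite ler01 lexx.
apply: (@grad_corner _ _ x0) => i t vt; rewrite wE ?h ?mul1r //.
exact: vertices_upd.
Qed.

Lemma nodal_gradient_minus : ~ (`I_(2 ^ d) #<= I) -> nodal_gradient_ok (- sv).
Proof.
move=> /corner_minus h.
split; first by move=> i; rewrite !mxE; case: (s_sign i) => ->; lra.
exists 0; first by rewrite ler01 lexx.
apply: (@grad_corner _ _ x0) => i t vt; rewrite wE ?mul0r; last exact: vertices_upd.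
by rewrite leNgt h.
Qed.

(** The point lies on the edge from [- sv] in direction [j]. Here [ell] is negative at [- sv] and
    nonnegative at the other end, and the two values differ by [2 * (s j * n j 0)]. Hence the
    quotient in the formula lies in [[0, 2]]: the point stays on the edge, and half the quotient is
    [lam]. *)
Lemma nodal_gradient_face j : (forall x, vertices R N x -> (0 <= ell x) = (x j 0 == s j)) ->
  nodal_gradient_ok (upd (- sv) j (s j * (ell (upd (- sv) j (s j)) / (s j * n j 0) - 1))).
Proof.
move=> hI; have p0 : 0 <= ell (upd (- sv) j (s j)).
  by rewrite hI ?mxE ?eqxx //; exact: vertices_upd.
have q0 : ell (- sv) < 0.
  rewrite ltNge hI // !mxE; case: (s_sign j) => ->; apply/eqP; lra.
have : ell (upd (- sv) j (s j)) = ell (- sv) + 2 * (s j * n j 0).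
  by rewrite dot_upd !mxE; ring.
have [D DE] : exists D, D = ell (upd (- sv) j (s j)) by eexists.
have [m mE] : exists m, m = s j * n j 0 by eexists.
rewrite -DE -mE in p0 *; move: (ell (- sv)) q0 => e q0 pE.
have m0 : 0 < m by lra.
have D2 : D / m <= 2 by rewrite ler_pdivrMr //; lra.
have D1 : 0 <= D / m by rewrite divr_ge0 // ltW.
have [th thE [th0 th1]] : exists2 th, D / m = 2 * th & 0 <= th /\ th <= 1.
  by exists (D / m / 2); [field; rewrite gt_eqF|lra].
rewrite thE.
split.
  move=> i; rewrite !mxE; case: eqP => _; first by case: (s_sign j) => ->; lra.
  by case: (s_sign i) => ->; lra.
exists th; first exact/andP.
apply: (@grad_edge _ _ x0) => //.
- by move=> y vy yj; rewrite wE // hI // yj eqxx.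
- move=> y vy yj; rewrite wE // hI // yj; case: eqP => //.
  by case: (s_sign j) => ->; lra.
- by rewrite -DE -mE -thE divfK // gt_eqF.
Qed.

End Cases.

(** * Undoing the signed permutation [G] of the selection rule *)

Variable P : {perm 'I_N}.
Let G := perm_mx P *m sign_mx n.

Lemma mul_signed_perm (y : V) i : (G *m y) i 0 = s (P i) * y (P i) 0.
Proof.
rewrite -mulmxA -row_permE mxE mul_diag_mx !mxE.
by rewrite /s /sgn; case: ifP.
Qed.

Lemma mulK_signed_perm (y : V) i : (invmx G *m y) i 0 = s i * y ((P^-1)%g i) 0.
Proof.
have GU : G \in unitmx.
  rewrite unitmx_mul unitmx_perm unitmxE det_diag unitfE.
  by apply/prodf_neq0 => j _; rewrite mxE; case: ifP; rewrite ?oppr_eq0 oner_eq0.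
have -> : y = G *m (\col_k (s k * y ((P^-1)%g k) 0)).
  by apply/colP => k; rewrite mul_signed_perm mxE permK mulrA s2 mul1r.
by rewrite mulKmx // mul_signed_perm !mxE permKV mulrA s2 mul1r.
Qed.

Lemma image_signed_perm (J : set V) x : [set G *m y | y in J] (G *m x) -> J x.
Proof.
move=> [y Jy /colP yx]; suff -> : x = y by [].
apply/colP => k; have := yx ((P^-1)%g k); rewrite !mul_signed_perm permKV.
by case: (s_sign k) => ->; lra.
Qed.

Lemma signed_perm_ones (y : V) : (forall i, y i 0 = 1) -> invmx G *m y = sv.
Proof. by move=> y1; apply/colP => i; rewrite mulK_signed_perm y1 mulr1 mxE. Qed.

Lemma signed_perm_Nones (y : V) : (forall i, y i 0 = -1) -> invmx G *m y = - sv.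
Proof. by move=> y1; apply/colP => i; rewrite mulK_signed_perm y1 mulrN1 !mxE. Qed.

Lemma signed_perm_edge (y : V) : (forall i, i != 0 -> y i 0 = -1) ->
  invmx G *m y = upd (- sv) (P 0) (s (P 0) * y 0 0).
Proof.
move=> y1; apply/colP => i; rewrite mulK_signed_perm !mxE.
case: eqP => [->|iP]; first by rewrite permK.
rewrite y1 ?mulrN1 //; apply/eqP => i0; apply: iP.
by rewrite -i0 permKV.
Qed.

Lemma vertices_signed_perm x : vertices R N x -> vertices R N (G *m x).
Proof.
move=> vx i; rewrite mul_signed_perm.
by case: (s_sign (P i)) (vx (P i)) => -> [] ->; [right|left|left|right]; ring.
Qed.

(** [G] sends [sv] to the all-ones vertex, so the neighbours of [sv] become points that differ from
    it in one coordinate. *)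
Lemma signed_perm_upd i t : t = -1 \/ t = 1 -> exists2 u, u = -1 \/ u = 1 &
  G *m upd sv i t = \col_k if k == (P^-1)%g i then u else 1.
Proof.
move=> vt; exists (s i * t).
  by case: (s_sign i) vt => -> [] ->; [right|left|left|right]; ring.
apply/colP => k; rewrite mul_signed_perm !mxE (canF_eq (permK P)).
by case: eqP => [->|_]; rewrite ?permKV ?s2.
Qed.

Lemma face_signed_perm :
  [set G *m x | x in I] = vertices R N `&` [set x | x 0 0 = 1] ->
  forall x, vertices R N x -> (0 <= ell x) = (x (P 0) 0 == s (P 0)).
Proof.
move=> It x vx; apply/idP/eqP => [Ix|xs].
  have : [set G *m y | y in I] (G *m x) by exists x.
  rewrite It => -[_ /=]; rewrite mul_signed_perm.
  by case: (s_sign (P 0)) => ->; lra.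
suff : [set G *m y | y in I] (G *m x) by move=> /image_signed_perm[].
rewrite It; split; first exact: vertices_signed_perm.
by rewrite /= mul_signed_perm xs s2.
Qed.

End FluxPoint.

(** * Gradient of the interpolant at the selected flux point *)

Lemma card_II_sandwich {T : Type} (J : set T) a b : (b < a)%N ->
  `I_a #<= J -> ~ (J #<= `I_b).
Proof.
by move=> ba aJ /(card_le_trans aJ); rewrite card_le_II leqNgt ba.
Qed.

(** The rule compares the size of [I] with [2 ^ d], the size of a face: above it [M] is the corner
    [sv], below it the corner [- sv]. At equality, [I] is a face, which gives the edge point, or for
    [N = 3] the star, which gives [sv] again. *)
Lemma flux_point_gradient {R : realType} (d : nat) (x0 n M : 'cV[R]_d.+1) (w : Q1 R d.+1) :
  flux_point (fun x => dot (x - x0) n) n M ->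
  (forall x, vertices R d.+1 x -> q1eval w x =
     if 0 <= dot (x - x0) n then dot (x - x0) n else 0) ->
  Khat R d.+1 M /\ exists2 lam : R, 0 <= lam <= 1 & grad (q1eval w) M = lam *: n.
Proof.
move=> [_ [Mt [/is_perm_mxP[P ->] -> [|]]]].
  case=> -[dE]; subst d; case=> [[cI ->]|[cI ->]|[cI It] /= ->] wE.
  - rewrite signed_perm_ones; last by move=> [[|[|//]] ?]; rewrite mxE.
    apply: (nodal_gradient_plus wE); left; apply: (@card_II_sandwich _ _ 3) => //.
    by move: cI; rewrite card_eq_le => /andP[].
  - rewrite signed_perm_Nones; last by move=> [[|[|//]] ?]; rewrite mxE.
    apply: (nodal_gradient_minus wE) => /card_II_sandwich; apply; first exact: (ltnSn 1).
    by move: cI; rewrite card_eq_le => /andP[].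
  - rewrite !signed_perm_edge; try by move=> [[|[|//]] ?] // _; rewrite mxE.
    rewrite mul_signed_perm !mxE /= mulr1.
    apply: (nodal_gradient_face wE); apply: face_signed_perm; rewrite It.
    (* In the plane the rule lists the two vertices of the side; they are rewritten as the face on
       which the first coordinate is 1. *)
    apply/seteqP; split=> [x [] ->|x [vx x0E]].
    + split; last by rewrite /= mxE.
      by move=> [[|[|//]] ?]; rewrite mxE /=; (by left) || by right.
    + split; last by rewrite /= mxE.
      by move=> [[|[|//]] ?]; rewrite mxE /=; (by left) || by right.
    + have x1 : x = colvec [:: 1; x 1 0].
        by apply/colP => -[[|[|//]] k]; rewrite mxE /= -?x0E; congr (x _ _); apply: val_inj.
      by case: (vx 1) x1 => -> ->; [left|right].
case=> -[dE]; subst d; case=> [[cI ->]|[cI ->]|[cI It] /= ->] wE.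
- rewrite signed_perm_ones; last by move=> [[|[|[|//]]] ?]; rewrite mxE.
  apply: (nodal_gradient_plus wE); case: cI => [cI|It].
    by left; apply: card_II_sandwich cI.
  (* The star consists of the all-ones vertex and its three neighbours, so membership in [I] is
     checked in the coordinates of [G] and pulled back by injectivity. *)
  right=> i t vt; suff : [set (perm_mx P *m sign_mx n) *m x | x in
      Ih_plus (fun x : 'cV[R]_3 => dot (x - x0) n)]
      ((perm_mx P *m sign_mx n) *m upd (\col_i sgn (0 <= n i 0)) i t).
    by move=> /image_signed_perm[].
  rewrite It; have [u [] -> ->] := signed_perm_upd n P i vt; last first.
    by right; apply/colP => -[[|[|[|//]]] ?]; rewrite !mxE; case: eqP.
  move: ((P^-1)%g i) => [[|[|[|//]]] ?]; [left; right|left; left; right|left; left; left];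
    by apply/colP => -[[|[|[|//]]] ?]; rewrite !mxE.
- rewrite signed_perm_Nones; last by move=> [[|[|[|//]]] ?]; rewrite mxE.
  by apply: (nodal_gradient_minus wE) => /card_II_sandwich; apply; last exact: cI.
- rewrite !signed_perm_edge; try by move=> [[|[|[|//]]] ?] // _; rewrite mxE.
  rewrite mul_signed_perm !mxE /= mulr1.
  by apply: (nodal_gradient_face wE); apply: face_signed_perm; rewrite It.
Qed.

(** * Sides of the interface and positivity of the pulled-back coefficients *)

Lemma domain_dichotomy {R : realType} {N : nat} (Omega Gamma Om Op : set 'cV[R]_N)
    (nu : 'cV[R]_N -> 'cV[R]_N) (y : 'cV[R]_N) :
  interface_domain Omega Gamma Om Op nu -> Omega y ->
  (Op y /\ ~ Om y) \/ (~ Op y /\ Om y).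
Proof.
move=> dom Oy.
have splitE := dom_split dom; have disj := separated_disjoint (dom_separated dom).
have OmG : Om y -> ~ Gamma y.
  move=> my; have [] : (Omega `\` Gamma) y by rewrite splitE; left.
  by [].
have OmOp : Om y -> ~ Op y.
  move=> my py; have : (Om `&` (Op `\` Gamma)) y by split=> //; split=> //; exact: OmG.
  by rewrite disj.
have [Gy|nGy] := pselect (Gamma y).
  by left; split; [exact: (Gamma_plus dom)|move=> /OmG].
have : (Omega `\` Gamma) y by [].
rewrite splitE => -[my|[py _]]; first by right; split=> //; exact: OmOp.
by left; split=> // /OmOp.
Qed.

(** With [z] the image of [n] under the inverse transpose of the Jacobian, the quadratic form of
    [Bcal] at [n] is that of [B y] at [z], and [z] is nonzero. *)
Lemma Bcal_pos {R : realType} {N : nat} (A : set 'cV[R]_N) (B : 'cV[R]_N -> 'M[R]_N)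
    (bmin bmax : R) (E : element R N) (x y n : 'cV[R]_N) :
  coefficient A B bmin bmax -> A y -> 0 < \det (jac E x) -> n != 0 ->
  0 < dot (Bcal E (B y) x *m n) n.
Proof.
move=> hB Ay detJ n0; set J := jac E x in detJ *.
have JU : J \in unitmx by rewrite unitmxE unitfE gt_eqF.
rewrite /Bcal -!mulmxA dot_mul_tr dotC.
set z := _ *m n; have z0 : z != 0.
  apply: contra_neq n0 => zE.
  have -> : n = J^T *m z by rewrite mulmxA -trmx_mul mulVmx // trmx1 mul1mx.
  by rewrite zE mulmx0.
have /andP[h _] := coef_bounds hB z Ay.
by apply: lt_le_trans h; rewrite mulr_gt0 ?(coef_bmin hB) // enorm_sqr dot_gt0.
Qed.

Lemma Finv_cell {R : realType} {N : nat} (E : element R N) (y : 'cV[R]_N) :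
  cell E y -> Khat R N (Finv E y).
Proof.
move=> Ey; have surj : set_surj (Khat R N) (cell E) (F E) by move=> z [x Kx <-]; exists x.
by apply: (surjpinv_image_sub (dflt := fun=> 0) surj); exists y.
Qed.

Lemma nhat_unit {R : realType} {N : nat} (E : element R N) (xK nh : 'cV[R]_N) :
  0 < \det (jac E (xhat E xK)) -> enorm nh = 1 ->
  dot (nhat E xK nh) (nhat E xK nh) = 1.
Proof.
move=> detJ n1; apply: dot_normalized; set J := jac _ _ in detJ *.
have JU : J^T \in unitmx by rewrite unitmx_tr unitmxE unitfE gt_eqF.
have : dot nh nh != 0 by rewrite -enorm_sqr n1 expr1n oner_eq0.
apply: contra_neq => h.
have -> : nh = invmx J^T *m (J^T *m nh) by rewrite mulmxA mulVmx // mul1mx.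
by rewrite h mulmx0 /dot big1 // => i _; rewrite mxE mul0r.
Qed.

Lemma q1_nodal_values {R : realType} {N : nat} {I : finType} (A : I -> Khat R N)
    (c : I -> R) : injective A ->
  exists u : Q1 R N, forall i, vertices R N (val (A i)) -> q1eval u (val (A i)) = c i.
Proof.
(* The default 0 is taken only at points outside the list [A]; injectivity of [A] makes the picked
   index the intended one. *)
move=> Ainj; pose f x := if [pick i | val (A i) == x] is Some i then c i else 0.
have [u uE] := q1_interpolation f; exists u => i vi; rewrite uE // /f.
case: pickP => [k /eqP /val_inj /Ainj -> //|/(_ i)]; by rewrite eqxx.
Qed.

(** * The scalar equation for the jump parameter *)

Section Solve.
Context {R : realType} {N : nat}.
Local Notation V := 'cV[R]_N.
Variables (x0 n M : V) (Bp Bm : 'M[R]_N) (w L u : Q1 R N) (lam : R).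
Local Notation ell x := (dot (x - x0) n).
Hypothesis n1 : dot n n = 1.
Hypothesis Bp0 : 0 < dot (Bp *m n) n.
Hypothesis Bm0 : 0 < dot (Bm *m n) n.
Hypothesis wE : forall x, vertices R N x ->
  q1eval w x = if 0 <= ell x then ell x else 0.
Hypothesis LE : forall x, q1eval L x = ell x.
Hypothesis lam01 : 0 <= lam <= 1.
Hypothesis wM : grad (q1eval w) M = lam *: n.

Let kappa := (1 - lam) * dot (Bp *m n) n + lam * dot (Bm *m n) n.
Let rhs := dot (Bm *m grad (q1eval u) M) n - dot (Bp *m grad (q1eval u) M) n.

(** At [M] the gradients are those of [u] plus [a * (1 - lam)] times [n] on the plus side and minus
    [a * lam] times [n] on the minus side. *)
Lemma flux_jump (a : R) :
  dot (Bp *m grad (q1eval (u - a *: w + a *: L)) M) n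
    - dot (Bm *m grad (q1eval (u - a *: w)) M) n = a * kappa - rhs.
Proof.
have LM : grad (q1eval L) M = n.
  by rewrite (@grad_corner _ _ x0 n L 1) ?scale1r // => i t _; rewrite LE mul1r.
rewrite gradD gradB !gradZ wM LM !mulmxDr !mulmxN -!scalemxAr !dotDl !dotZl.
rewrite -[- (a *: _)]scaleN1r -[- (_ *: (_ *: (Bm *m n)))]scaleN1r !dotZl.
by rewrite /kappa /rhs; ring.
Qed.

Lemma flux_coefficient_gt0 : 0 < kappa.
Proof.
rewrite /kappa; have /andP[l0 l1] := lam01.
have [->|lN0] := eqVneq lam 0; first by rewrite subr0 mul1r mul0r addr0.
apply: ltr_wpDl; first by rewrite mulr_ge0 ?subr_ge0 // ltW.
by rewrite mulr_gt0 // lt_def lN0.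
Qed.

Lemma ife_pair_unique (vp vm : Q1 R N) :
  (forall al, (2 <= mdeg al)%N -> vp al - vm al = 0) ->
  (forall x, ell x = 0 -> q1eval vp x - q1eval vm x = 0) ->
  dot (Bp *m grad (q1eval vp) M) n - dot (Bm *m grad (q1eval vm) M) n = 0 ->
  (forall x, vertices R N x ->
     (if 0 <= ell x then q1eval vp x else q1eval vm x) = q1eval u x) ->
  let a := rhs / kappa in
  q1eval vp = q1eval (u - a *: w + a *: L) /\ q1eval vm = q1eval (u - a *: w).
Proof.
move=> hc hH hM hv.
have [|||a aE] := @q1_vanishing_on_hyperplane _ _ (vp - vm) x0 n.
- by move=> al /hc; rewrite !ffunE.
- exact: n1.
- by move=> x /hH; rewrite q1evalB.
have vpE x : q1eval vp x = q1eval vm x + a * ell x by rewrite -aE q1evalB addrC subrK.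
(* At a vertex with [ell] nonnegative the nodal value belongs to [vp], so [vm] is short of it by
   [a * ell]; elsewhere [vm] carries it itself. The values of [w] cover both cases. *)
have vmE : q1eval vm = q1eval (u - a *: w).
  apply: q1eval_eq => x vx; rewrite q1evalB q1evalZ wE // -hv // vpE.
  by case: (0 <= ell x); ring.
have {}vpE : q1eval vp = q1eval (u - a *: w + a *: L).
  by apply/funext => x; rewrite vpE vmE [RHS]q1evalD q1evalZ LE.
suff -> : rhs / kappa = a by [].
move: hM; rewrite vpE vmE flux_jump => /eqP; rewrite subr_eq0 => /eqP <-.
by rewrite mulfK // gt_eqF // flux_coefficient_gt0.
Qed.

Lemma ife_pair_nodal (a : R) x : vertices R N x ->
  (if 0 <= ell x then q1eval (u - a *: w + a *: L) x else q1eval (u - a *: w) x) =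
  q1eval u x.
Proof.
move=> vx; rewrite q1evalD q1evalB !q1evalZ wE // LE.
by case: (0 <= ell x); ring.
Qed.

Lemma ife_pair_flux : let a := rhs / kappa in
  dot (Bp *m grad (q1eval (u - a *: w + a *: L)) M) n
    - dot (Bm *m grad (q1eval (u - a *: w)) M) n = 0.
Proof.
by rewrite /= flux_jump divfK ?subrr // gt_eqF // flux_coefficient_gt0.
Qed.

End Solve.

(** * Assembly on an interface element *)

Theorem lemma2p5 (R : realType) (d : nat) (hN : d.+1 = 2%N \/ d.+1 = 3%N)
    (Omega Gamma Om Op : set 'cV[R]_d.+1) (nu : 'cV[R]_d.+1 -> 'cV[R]_d.+1)
    (hdom : interface_domain Omega Gamma Om Op nu)
    (mesh : R -> set (element R d.+1))
    (hmesh : forall h : R, 0 < h -> conforming_mesh Omega (mesh h))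
    (xs ns : R -> element R d.+1 -> 'cV[R]_d.+1) (C : R) (hC : 0 < C)
    (hst : standing_assumption Gamma Op nu mesh xs ns C)
    (B : 'cV[R]_d.+1 -> 'M[R]_d.+1) (bminp bmaxp bminm bmaxm : R)
    (hBp : coefficient Op B bminp bmaxp) (hBm : coefficient Om B bminm bmaxm)
    (h : R) (hh : 0 < h) (K : element R d.+1) (hK : mesh h K)
    (hint : interface_element Gamma K)
    (xKp xKm : 'cV[R]_d.+1)
    (hxKp : (cell K `&` Op) xKp) (hxKm : (cell K `&` Om) xKm)
    (M : 'cV[R]_d.+1)
    (hM : flux_point (ellhat K (xs h K) (ns h K)) (nhat K (xs h K) (ns h K)) M)
    (A : 'I_(2 ^ d.+1) -> Khat R d.+1) (hAinj : injective A)
    (hA : [set val (A i) | i in [set: 'I_(2 ^ d.+1)]] = vertices R d.+1)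
    (c : 'I_(2 ^ d.+1) -> R) :
  exists! phi : Khat R d.+1 -> R,
    V_IFE Om Op K (xs h K) (ns h K) (B xKp) (B xKm) M phi /\
    forall i, phi (A i) = c i.
Proof.
have [[cellx n1] _ _ [plusE _] _] := hst h K hh hK hint.
set x0 := xhat K (xs h K); set n := nhat K (xs h K) (ns h K).
have detJ := mesh_det (hmesh h hh) hK.
have nn : dot n n = 1 by apply: nhat_unit => //; exact/detJ/Finv_cell.
have nN0 : n != 0.
  apply: contra_eq_neq nn => ->; rewrite /dot big1 => [|i _]; last by rewrite mxE mul0r.
  by rewrite eq_sym oner_eq0.
have [w wE] := q1_interpolation
  (fun x => if 0 <= dot (x - x0) n then dot (x - x0) n else 0).
have [L LE L2] := q1_distance x0 n.
have [KM [lam lam01 wM]] := flux_point_gradient hM wE.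
(* Since [M] lies in the reference element, the Jacobian determinant is positive at [M]. *)
have Bp0 := Bcal_pos hBp hxKp.2 (detJ M KM) nN0.
have Bm0 := Bcal_pos hBm hxKm.2 (detJ M KM) nN0.
have vA i : vertices R d.+1 (val (A i)) by rewrite -hA; exists i.
have [u uA] := q1_nodal_values c hAinj.
(* Every point of the reference element is on exactly one side, so two polynomials determine a
   function on it and the two defining conditions cannot conflict. *)
have dich (x : Khat R d.+1) :
    (pull K (cell K `&` Op) (val x) /\ ~ pull K (cell K `&` Om) (val x)) \/
    (~ pull K (cell K `&` Op) (val x) /\ pull K (cell K `&` Om) (val x)).
  have Kx : Khat R d.+1 (val x) by exact: set_mem (valP x).
  have cx : cell K (F K (val x)) by exists (val x).
  have Ox : Omega (F K (val x)).
    by rewrite -(mesh_cover (hmesh h hh)); exists K.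
  have [[px mx]|[px mx]] := domain_dichotomy hdom Ox; [left|right].
    by split; [split|move=> [_ []]].
  by split; [move=> [_ []]|split].
(* [phi] is split along the true interface while [w] is built from the sign of the linearised one;
   the standing assumption makes both splittings agree at the vertices. *)
have side x : vertices R d.+1 x -> 0 <= dot (x - x0) n <-> pull K (cell K `&` Op) x.
  move=> vx; have /seteqP[ph hp] := plusE; split=> [lx|px].
    by have [] := hp x (conj vx lx).
  by have [] := ph x (conj vx px).
pose kappa := (1 - lam) * dot (Bcal K (B xKp) M *m n) n +
  lam * dot (Bcal K (B xKm) M *m n) n.
pose rhs := dot (Bcal K (B xKm) M *m grad (q1eval u) M) n -
  dot (Bcal K (B xKp) M *m grad (q1eval u) M) n.
pose a := rhs / kappa.
pose vm := u - a *: w; pose vp := vm + a *: L.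
pose phi (x : Khat R d.+1) := if pselect (pull K (cell K `&` Op) (val x))
  then q1eval vp (val x) else q1eval vm (val x).
exists phi; split.
  split.
    exists vp, vm; split.
    - by move=> x px; rewrite /phi; case: pselect.
    - move=> x mx; rewrite /phi; case: pselect => // px.
      by case: (dich x) => -[].
    - move=> x; rewrite /Hhat /= /ellhat -/x0 -/n => hx.
      by rewrite /vp q1evalD q1evalZ LE hx mulr0 addr0 subrr.
    - exact: (ife_pair_flux u Bp0 Bm0 LE lam01 wM).
    - by move=> al /L2 L0; rewrite /vp !ffunE L0 /= scaler0 addr0 subrr.
  move=> i; rewrite -(uA i (vA i)) -(ife_pair_nodal u wE LE a (vA i)) /phi.
  have sd := side _ (vA i).
  by case: pselect => [/sd ->|px] //; case: ifP => // /sd.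
move=> psi [[qp [qm [hp hm hH hfl hc]]] hpsi].
(* Each vertex is some [A i], so the nodal values of [psi] are those of [u], read from [qp] or [qm]
   according to the side of the vertex. *)
have [qpE qmE] : q1eval qp = q1eval vp /\ q1eval qm = q1eval vm.
  apply: (ife_pair_unique nn Bp0 Bm0 wE LE lam01 wM hc hH hfl) => x vx.
  move: (vx); rewrite -hA => -[i _ xE]; move: vx; rewrite -xE => vx.
  rewrite uA // -hpsi; have sd := side _ vx.
  case: ifP => [/sd px|/negP lx]; first by rewrite hp.
  have [[/sd//]|[_ mx]] := dich (A i).
  by rewrite hm.
apply/funext => x; rewrite /phi; case: pselect => px; first by rewrite hp ?qpE.
by have [[//]|[_ mx]] := dich x; rewrite hm ?qmE.
Qed.
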